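(* Let $(\mathcal{M}^{\dagger},\textsf{AX}^{\dagger})$ be any one of the four pairs $(\mathcal{M},\textsf{AX})$, $(\mathcal{M}_{\mathrm{det}},\textsf{AX}_{\mathrm{det}})$, $(\mathcal{M}^{\downarrow},\textsf{AX}^{\downarrow})$, $(\mathcal{M}^{\downarrow}_{\mathrm{det}},\textsf{AX}^{\downarrow}_{\mathrm{det}})$. Then $\textsf{AX}^{\dagger}$ is sound and complete for validities with respect to $\mathcal{M}^{\dagger}$: for every $\varphi \in \mathcal{L}$, $\varphi$ is provable in $\textsf{AX}^{\dagger}$ if and only if $\mathfrak{M}\models\varphi$ for every model $\mathfrak{M}\in\mathcal{M}^{\dagger}$.
   Context: Language. Fix propositional atoms $X_1,X_2,X_3,\dots$. $\mathcal{L}_{\mathrm{prop}}$ is the set of propositional formulas over these atoms (closed under $\land,\lor,\lnot$). $\mathcal{L}_{\mathrm{int}}\subset\mathcal{L}_{\mathrm{prop}}$ consists of $\top$ together with all formulas $l_{i_1}\land\dots\land l_{i_n}$ with $i_1<i_2<\dots<i_n$ and each $l_{i_j}$ equal to $X_{i_j}$ or $\lnot X_{i_j}$. $\mathcal{L}_{\mathrm{cond}}$ is the set of formulas $[\alpha]\beta$ with $\alpha\in\mathcal{L}_{\mathrm{int}}$, $\beta\in\mathcal{L}_{\mathrm{prop}}$. $\mathcal{L}$ is the set of propositional formulas (closed under $\land,\lor,\lnot$) over the atoms $\{X_i\}\cup\mathcal{L}_{\mathrm{cond}}$. $\alpha\to\beta$ abbreviates $\lnot\alpha\lor\beta$, $\leftrightarrow$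 is defined as usual, and $\langle\alpha\rangle\beta$ abbreviates $\lnot[\alpha]\lnot\beta$. Semantics. A causal simulation model is a pair $(\mathsf{T},\mathbf{x})$ where $\mathsf{T}$ is a (possibly non-deterministic) Turing machine whose tape consists of binary variables $X_1,X_2,\dots$, and $\mathbf{x}=\{x_n\}_{n\in\mathbb{N}}$ is a state description assigning a value in $\{0,1\}$ to each tape variable, with only finitely many nonzero. A halting run of $\mathsf{T}$ on $\mathbf{x}$ yields an output state description. For $\alpha\in\mathcal{L}_{\mathrm{int}}$, the intervention $\mathcal{I}_\alpha$ maps $\mathsf{T}$ to the machine $\mathcal{I}_\alpha(\mathsf{T})$ that first sets each variable $X_i$ occurring in $\alpha$ to $1$ if $X_i$ is a literal of $\alpha$ and to $0$ if $\lnot X_i$ is, and then runs $\mathsf{T}$ while ignoring every write to those variables (so they stay fixed throughout). Satisfaction: $(\mathsf{T},\mathbf{x})\models X_i$ iff $x_i=1$; $(\mathsf{T},\mathbf{x})\models[\alpha]\beta$ iff every halting execution of $\mathcal{I}_\alpha(\mathsf{T})$ on $\mathbf{x}$ yields a tape satisfying $\beta$ (propositionally, with $X_i$ true iff its value is $1$); Boolean connectives are interpreted as usual. Thus $(\mathsf{T},\mathbf{x})\models\langle\alpha\rangle\beta$ iff some halting execution of $\mathcal{I}_\alpha(\mathsf{T})$ on $\mathbf{x}$ yields a tape satisfying $\beta$. Model classes. $\mathcal{M}$: all causal simulation models; $\mathcal{M}_{\mathrm{det}}$: those with deterministic $\mathsf{T}$; $\mathcal{M}^{\downarrow}$: those with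 (possibly non-deterministic) $\mathsf{T}$ that halt on all input tapes under all interventions; $\mathcal{M}^{\downarrow}_{\mathrm{det}}=\mathcal{M}_{\mathrm{det}}\cap\mathcal{M}^{\downarrow}$. Axiom systems (all formulas below range over $\alpha\in\mathcal{L}_{\mathrm{int}}$, $\beta,\beta',\gamma\in\mathcal{L}_{\mathrm{prop}}$): PC: propositional calculus over the atoms of $\mathcal{L}$; RW: from $\beta\to\beta'$ infer $[\alpha]\beta\to[\alpha]\beta'$; R: $[\alpha]\alpha$; K: $[\alpha](\beta\to\gamma)\to([\alpha]\beta\to[\alpha]\gamma)$; F: $\langle\alpha\rangle\beta\to[\alpha]\beta$; D: $[\alpha]\beta\to\langle\alpha\rangle\beta$. $\textsf{AX}$ contains axioms R and K and is closed under PC and RW; $\textsf{AX}_{\mathrm{det}}=\textsf{AX}+\textsf{F}$; $\textsf{AX}^{\downarrow}=\textsf{AX}+\textsf{D}$; $\textsf{AX}^{\downarrow}_{\mathrm{det}}=\textsf{AX}+\textsf{F}+\textsf{D}$. *)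

(* Defs.v *)
From HB Require Import structures.
From mathcomp Require Import all_boot finmap.
From Stdlib Require Import Relation_Operators.

Set Implicit Arguments.
Unset Strict Implicit.
Unset Printing Implicit Defensive.

(** * Language *)

Inductive form (A : Type) : Type :=
  | Atom of A
  | Top
  | Neg of form A
  | And of form A & form A
  | Or of form A & form A.

Arguments Top {A}.

Definition Imp (A : Type) (p q : form A) : form A := Or (Neg p) q.

(* Tape variables are numbered from 0: [Atom i : Lprop] and cell [i] are the
   variable X_{i+1}. *)
Definition Lprop : Type := form nat.

(* A literal (i, true) is X_{i+1}, and (i, false) is its negation. *)
Definition lit_form (l : nat * bool) : Lprop :=
  if l.2 then Atom l.1 else Neg (Atom l.1).

Fixpoint conj_lits (s : seq (nat * bool)) : Lprop :=
  match s with
  | [::] => Top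
  | [:: l] => lit_form l
  | l :: s' => And (lit_form l) (conj_lits s')
  end.

(* The empty list of literals is the formula ⊤. *)
Definition Lint : Type :=
  {s : seq (nat * bool) | sorted ltn [seq l.1 | l <- s]}.

Definition literals (a : Lint) : seq (nat * bool) := sval a.

Definition form_of_int (a : Lint) : Lprop := conj_lits (literals a).

(* The atom [inr (a, b)] is the conditional formula [a]b. *)
Definition Lcond : Type := (Lint * Lprop)%type.

Definition L : Type := form (nat + Lcond)%type.

Fixpoint emb (b : Lprop) : L :=
  match b with
  | Atom i => Atom (inl i)
  | Top => Top
  | Neg p => Neg (emb p)
  | And p q => And (emb p) (emb q)
  | Or p q => Or (emb p) (emb q)
  end.

Definition Box (a : Lint) (b : Lprop) : L := Atom (inr (a, b)).

Definition Dia (a : Lint) (b : Lprop) : L := Neg (Box a (Neg b)).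

(** * Turing machines over a one-way infinite tape of binary variables *)

Definition tape : Type := {fsfun nat -> bool with false}.

Definition set_cell (x : tape) (i : nat) (b : bool) : tape :=
  [fsfun j in (i |` finsupp x)%fset => if j == i then b else x j | false].

Inductive move : Type := MoveL | MoveR | Stay.

(* The head starts on X_1; moving left from there leaves it in place. *)
Definition move_head (m : move) (h : nat) : nat :=
  match m with MoveL => h.-1 | MoveR => h.+1 | Stay => h end.

(* [tm_delta T q b q' b' m] holds when, in state [q] and reading [b], the
   machine may enter state [q'], write [b'] and make the move [m].  A machine
   halts when no transition is available. *)
Record TM : Type := MkTM {
  tm_state : finType;
  tm_start : tm_state;
  tm_delta : tm_state -> bool -> tm_state -> bool -> move -> bool
}.

Definition deterministic (T : TM) : Prop :=
  forall (q : tm_state T) (b : bool) q1 b1 m1 q2 b2 m2,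
    tm_delta q b q1 b1 m1 -> tm_delta q b q2 b2 m2 ->
    (q1, b1, m1) = (q2, b2, m2).

Record config (T : TM) : Type := Config {
  cfg_state : tm_state T;
  cfg_head : nat;
  cfg_tape : tape
}.

(** ** The intervened machine I_a(T)

    Writes to the cells fixed by [a] depend on the head position, which a
    finite control cannot track; I_a(T) is therefore given by its initial
    configurations and its transitions. *)

Definition intervened (a : Lint) (i : nat) : bool :=
  i \in [seq l.1 | l <- literals a].

Definition set_lits (a : Lint) (x : tape) : tape :=
  foldl (fun y l => set_cell y l.1 l.2) x (literals a).

Definition write (a : Lint) (x : tape) (i : nat) (b : bool) : tape :=
  if intervened a i then x else set_cell x i b.

Definition init (T : TM) (a : Lint) (x : tape) : config T :=
  Config (tm_start T) 0 (set_lits a x).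

Inductive step (T : TM) (a : Lint) : config T -> config T -> Prop :=
  | Step (q : tm_state T) (h : nat) (x : tape) q' b m :
      tm_delta q (x h) q' b m ->
      step a (Config q h x) (Config q' (move_head m h) (write a x h b)).

Definition halted (T : TM) (a : Lint) (c : config T) : Prop :=
  forall c', ~ step a c c'.

(* Some halting execution of I_a(T) on [x] yields the tape [y]. *)
Definition yields (T : TM) (a : Lint) (x y : tape) : Prop :=
  exists c : config T,
    [/\ clos_refl_trans _ (@step T a) (init T a x) c,
        halted a c
      & cfg_tape c = y].

(* Every execution of I_a(T) on [x] halts. *)
Definition halts (T : TM) (a : Lint) (x : tape) : Prop :=
  ~ exists run : nat -> config T,
      run 0 = init T a x /\ forall n, step a (run n) (run n.+1).

(** * Causal simulation models and satisfaction *)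

Record model : Type := Model { md_machine : TM; md_tape : tape }.

Fixpoint eval (A : Type) (v : A -> Prop) (p : form A) : Prop :=
  match p with
  | Atom x => v x
  | Top => True
  | Neg q => ~ eval v q
  | And q r => eval v q /\ eval v r
  | Or q r => eval v q \/ eval v r
  end.

Definition tape_sat (y : tape) (b : Lprop) : Prop := eval (fun i => y i) b.

Definition atom_sat (M : model) (x : nat + Lcond) : Prop :=
  match x with
  | inl i => md_tape M i
  | inr (a, b) =>
      forall y, yields (md_machine M) a (md_tape M) y -> tape_sat y b
  end.

Definition sat (M : model) (phi : L) : Prop := eval (atom_sat M) phi.

Definition M_all (M : model) : Prop := True.

Definition M_det (M : model) : Prop := deterministic (md_machine M).

(* Halting is required on all input tapes, not only on [md_tape M]. *)
Definition M_halt (M : model) : Prop :=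
  forall (a : Lint) (x : tape), halts (md_machine M) a x.

Definition M_det_halt (M : model) : Prop := M_det M /\ M_halt M.

(** * Axiom systems *)

(* Kleene's axioms for the classical propositional calculus; the rule is modus
   ponens. *)
Inductive PC_axiom : L -> Prop :=
  | PC_K p q : PC_axiom (Imp p (Imp q p))
  | PC_S p q r :
      PC_axiom (Imp (Imp p q) (Imp (Imp p (Imp q r)) (Imp p r)))
  | PC_andI p q : PC_axiom (Imp p (Imp q (And p q)))
  | PC_andEl p q : PC_axiom (Imp (And p q) p)
  | PC_andEr p q : PC_axiom (Imp (And p q) q)
  | PC_orIl p q : PC_axiom (Imp p (Or p q))
  | PC_orIr p q : PC_axiom (Imp q (Or p q))
  | PC_orE p q r :
      PC_axiom (Imp (Imp p r) (Imp (Imp q r) (Imp (Or p q) r)))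
  | PC_negI p q : PC_axiom (Imp (Imp p q) (Imp (Imp p (Neg q)) (Neg p)))
  | PC_dne p : PC_axiom (Imp (Neg (Neg p)) p)
  | PC_top : PC_axiom Top.

Inductive axiom_F : L -> Prop :=
  | AxF a b : axiom_F (Imp (Dia a b) (Box a b)).

Inductive axiom_D : L -> Prop :=
  | AxD a b : axiom_D (Imp (Box a b) (Dia a b)).

(* Theorems of the system AX extended with the axioms [Ax]. *)
Inductive AX_plus (Ax : L -> Prop) : L -> Prop :=
  | AX_PC p : PC_axiom p -> AX_plus Ax p
  | AX_MP p q : AX_plus Ax (Imp p q) -> AX_plus Ax p -> AX_plus Ax q
  | AX_RW a b b' :
      AX_plus Ax (emb (Imp b b')) -> AX_plus Ax (Imp (Box a b) (Box a b'))
  | AX_R a : AX_plus Ax (Box a (form_of_int a))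
  | AX_K a b c :
      AX_plus Ax (Imp (Box a (Imp b c)) (Imp (Box a b) (Box a c)))
  | AX_extra p : Ax p -> AX_plus Ax p.

Definition AX : L -> Prop := AX_plus (fun _ => False).
Definition AX_det : L -> Prop := AX_plus axiom_F.
Definition AX_halt : L -> Prop := AX_plus axiom_D.
Definition AX_det_halt : L -> Prop :=
  AX_plus (fun p => axiom_F p \/ axiom_D p).

Inductive variant : Type := Any | Det | Halt | DetHalt.

Definition model_class (v : variant) : model -> Prop :=
  match v with
  | Any => M_all
  | Det => M_det
  | Halt => M_halt
  | DetHalt => M_det_halt
  end.

Definition provable (v : variant) : L -> Prop :=
  match v with
  | Any => AX
  | Det => AX_det
  | Halt => AX_halt
  | DetHalt => AX_det_halt
  end.

(* Main.v *)
(* Completeness: a formula phi that is not provable is avoided by some maximal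
   theory X (Zorn), which decides every formula.  Let N bound the variables of
   phi.  In X, [a]b holds iff b is true at each "possible" assignment of the
   first N cells, i.e. each one whose diagram d satisfies <a>d in X.  So it
   suffices to build one machine that, under every intervention a on the first
   N cells, outputs exactly the possible assignments for a.  The machine walks
   right, flipping and rereading each cell to find out which cells are fixed
   and to what values, thereby identifying a; it then picks a possible
   assignment (looping if there is none) and writes it while walking left.
   F makes the choice unique, and D makes it always available. *)

Require Import Defs.
From mathcomp Require Import all_boot finmap boolp classical_sets.
From Stdlib Require Import Relation_Operators Operators_Properties.

Set Implicit Arguments.
Unset Strict Implicit.
Unset Printing Implicit Defensive.

(** * Formulas and their evaluation *)

(** With [h := succn], [bound h b <= N] says that every variable of [b] is among the first [N]
    cells. *)
Fixpoint bound (A : Type) (h : A -> nat) (p : form A) : nat :=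
  match p with
  | Atom x => h x
  | Top => 0
  | Neg q => bound h q
  | And q r | Or q r => maxn (bound h q) (bound h r)
  end.

Lemma eval_ext (A : Type) (h : A -> nat) N (u v : A -> Prop) (p : form A) :
  bound h p <= N -> (forall x, h x <= N -> (u x <-> v x)) ->
  eval u p <-> eval v p.
Proof.
move=> + uv; elim: p => [x /uv||q IHq /IHq|q IHq r IHr|q IHq r IHr] //=;
  rewrite ?geq_max; [tauto| |]; by move=> /andP[/IHq + /IHr]; tauto.
Qed.

Lemma eval_Imp (A : Type) (v : A -> Prop) (p q : form A) :
  eval v (Imp p q) <-> (eval v p -> eval v q).
Proof. by rewrite /=; have [] := EM (eval v p); tauto. Qed.

Lemma eval_emb (v : nat + Lcond -> Prop) (b : Lprop) :
  eval v (emb b) <-> eval (v \o inl) b.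
Proof. by elim: b => //= [q|q IHq r|q IHq r]; tauto. Qed.

Lemma eval_conj_lits (v : nat -> Prop) (s : seq (nat * bool)) :
  eval v (conj_lits s) <-> (forall l, l \in s -> (v l.1 <-> l.2)).
Proof.
have lit l : eval v (lit_form l) <-> (v l.1 <-> l.2).
  have T : true by [].
  have nF : ~ false by [].
  by case: l => i [] /=; tauto.
elim: s => [//|l [|k s] IHs].
  rewrite lit; split=> [lv k|]; last by apply; rewrite mem_head.
  by rewrite inE => /eqP->.
rewrite [eval _ _]/= -/(conj_lits (k :: s)) lit IHs; split.
  by move=> [lv sv] j; rewrite inE => /predU1P[->//|]; apply: sv.
by move=> H; split=> [|j js]; apply: H; rewrite inE ?eqxx // js orbT.
Qed.

(** * Derivations and maximal theories *)

Section MaximalTheories.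

Variable Ax : L -> Prop.

(** Hypotheses enter only through modus ponens; RW stays confined to theorems, which is what makes
    the deduction theorem hold. *)
Inductive derives (G : L -> Prop) : L -> Prop :=
  | derives_thm p : AX_plus Ax p -> derives G p
  | derives_hyp p : G p -> derives G p
  | derives_mp p q : derives G (Imp p q) -> derives G p -> derives G q.

Definition extend (G : L -> Prop) (p : L) : L -> Prop := fun q => G q \/ q = p.

Lemma derives_sub (G H : L -> Prop) p :
  (forall q, G q -> H q) -> derives G p -> derives H p.
Proof.
move=> GH; elim=> [q|q /GH|q r _ IHq _ IHr].
- exact: derives_thm.
- exact: derives_hyp.
- exact: derives_mp IHq IHr.
Qed.

Lemma derives_PC G p : PC_axiom p -> derives G p.
Proof. by move=> /AX_PC/derives_thm; apply. Qed.

Lemma derives_last G p : derives (extend G p) p.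
Proof. by apply: derives_hyp; right. Qed.

Lemma derives_weak G p q : derives G q -> derives (extend G p) q.
Proof. by apply: derives_sub; left. Qed.

Lemma derives_cst G p q : derives G p -> derives G (Imp q p).
Proof. by apply: derives_mp; apply: derives_PC; constructor. Qed.

Lemma deduction G p q : derives (extend G p) q -> derives G (Imp p q).
Proof.
elim=> [r /derives_thm/derives_cst//|r [/derives_hyp/derives_cst//|->]|].
  (* The hypothesis [p] itself: [Imp p p] comes from S and two instances of K. *)
  apply: derives_mp (derives_PC _ (PC_K p (Imp p p))).
  apply: derives_mp (derives_PC _ (PC_K p p)).
  exact: derives_PC (PC_S _ _ _).
move=> r s _ IHr _ IHs.
apply: derives_mp IHr; apply: derives_mp IHs.
exact: derives_PC (PC_S _ _ _).
Qed.

Lemma derives_neg G p q :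
  derives (extend G p) q -> derives (extend G p) (Neg q) -> derives G (Neg p).
Proof.
move=> /deduction Gq /deduction; apply: derives_mp; apply: derives_mp Gq.
exact: derives_PC (PC_negI _ _).
Qed.

Lemma derives_absurd G p q :
  derives (extend G (Neg p)) q -> derives (extend G (Neg p)) (Neg q) ->
  derives G p.
Proof.
by move=> Gq /(derives_neg Gq); apply: derives_mp; apply: derives_PC; constructor.
Qed.

(** A derivation uses finitely many hypotheses, so one member of the chain contains them all. The
    first alternative covers derivations without hypotheses, in particular the empty chain. *)
Lemma derives_chain (F : set (set L)) p :
  total_on F subset -> derives (\bigcup_(X in F) X)%classic p ->
  derives set0 p \/ exists2 X, F X & derives X p.
Proof.
move=> tF; elim=> [q thq|q [X FX Xq]|q r _ IHq _ IHr].
- by left; apply: derives_thm.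
- by right; exists X => //; apply: derives_hyp.
case: IHq => [q0|[X FX Xq]]; case: IHr => [r0|[Y FY Yr]].
- by left; apply: derives_mp r0.
- by right; exists Y => //; apply: derives_mp Yr; apply: derives_sub q0.
- by right; exists X => //; apply: derives_mp Xq _; apply: derives_sub r0.
- right; case: (tF X Y FX FY) => sXY; [exists Y|exists X] => //.
    by apply: derives_mp Yr; apply: derives_sub Xq.
  by apply: derives_mp Xq _; apply: derives_sub Yr.
Qed.

(** This plays the part of a maximal consistent set containing [Neg phi], in the form that Zorn's
    lemma delivers. *)
Definition maximal_avoiding (phi : L) (X : L -> Prop) : Prop :=
  ~ derives X phi /\ forall p, ~ X p -> derives (extend X p) phi.

Lemma exists_maximal_avoiding phi :
  ~ AX_plus Ax phi -> exists X, maximal_avoiding phi X.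
Proof.
move=> nphi; have n0 : ~ derives set0 phi.
  by move=> d; apply: nphi; elim: d => // p q _ pq _; apply: AX_MP pq.
have [F FP tF|X [XP Xmax]] := @Zorn_bigcup L [set X | ~ derives X phi]%classic.
  by move=> /(derives_chain tF)[//|[X /FP]].
exists X; split=> // p nXp; apply: contrapT; apply: Xmax; split.
  by move=> q; left.
by move=> /(_ p (or_intror erefl)).
Qed.

(** * Maximal theories as propositional valuations *)

Section Maximal.

Variables (phi : L) (X : L -> Prop).
Hypothesis Xmax : maximal_avoiding phi X.

Lemma maximal_derives p : derives X p -> X p.
Proof.
move=> Xp; apply: contrapT => /(Xmax.2)/deduction H.
exact: Xmax.1 (derives_mp H Xp).
Qed.

Lemma maximal_thm p : AX_plus Ax p -> X p.
Proof. by move=> /derives_thm-/(_ X)/maximal_derives. Qed.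

Lemma maximal_mp p q : X (Imp p q) -> X p -> X q.
Proof.
move=> Xpq Xp; apply: maximal_derives.
by apply: derives_mp (derives_hyp Xpq) (derives_hyp Xp).
Qed.

Lemma maximal_PC p : PC_axiom p -> X p.
Proof. by move=> /AX_PC/maximal_thm. Qed.

(** If [X] contained neither [p] nor [Neg p], both would imply [phi] over [X], and excluded middle
    would give [phi]. *)
Lemma maximal_Neg p : X (Neg p) <-> ~ X p.
Proof.
split=> [Xnp Xp|nXp].
  apply: Xmax.1; apply: (@derives_absurd _ _ p); apply: derives_weak;
  exact: derives_hyp.
apply: contrapT => nXnp; apply: Xmax.1.
apply: (@derives_absurd _ _ phi); last exact: derives_last.
apply: (derives_mp (derives_weak _ (deduction (Xmax.2 _ nXnp)))).
apply: (@derives_neg _ _ phi); last exact/derives_weak/derives_last.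
apply: (derives_mp _ (derives_last _ _)); do 2 apply: derives_weak.
by apply: deduction; apply: Xmax.2.
Qed.

(** Conditionals are atoms of [L], so the induction is purely propositional. For [Or]: if [X]
    contained neither disjunct, each would imply [phi], hence so would the disjunction. *)
Lemma maximal_truth p : X p <-> eval (X \o @Atom _) p.
Proof.
elim: p => [x||p IHp|p IHp q IHq|p IHp q IHq] //=.
- by split=> // _; apply: maximal_PC; constructor.
- by rewrite maximal_Neg IHp.
- rewrite -IHp -IHq; split=> [Xpq|[Xp Xq]].
    by split; apply: maximal_mp Xpq; apply: maximal_PC; constructor.
  apply: maximal_mp Xq; apply: maximal_mp Xp.
  exact: maximal_PC (PC_andI _ _).
- rewrite -IHp -IHq; split=> [Xpq|[Xp|Xq]]; last 2 first.
  + by apply: maximal_mp Xp; apply: maximal_PC; constructor.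
  + by apply: maximal_mp Xq; apply: maximal_PC; constructor.
  apply: contrapT => /not_orP[/(Xmax.2)/deduction Hp /(Xmax.2)/deduction Hq].
  apply: Xmax.1; apply: derives_mp (derives_hyp Xpq); apply: derives_mp Hq.
  by apply: derives_mp Hp; apply: derives_PC; constructor.
Qed.

End Maximal.

(** Completeness of the propositional calculus; it lets RW be applied to semantic consequences. *)
Lemma tautology_provable (b : Lprop) :
  (forall v, eval v b) -> AX_plus Ax (emb b).
Proof.
move=> tb; apply: contrapT => /exists_maximal_avoiding[X Xmax].
apply: (Xmax.1); apply/derives_hyp/(maximal_truth Xmax)/eval_emb; exact: tb.
Qed.

(** * Boxed consequences in a maximal theory *)

Section Boxes.

Variables (phi : L) (X : L -> Prop).
Hypothesis Xmax : maximal_avoiding phi X.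

Lemma maximal_Box_int a : X (Box a (form_of_int a)).
Proof. exact: (maximal_thm Xmax (AX_R _ _)). Qed.

(** Induction on [s]: each premise [f t] is moved into the conclusion as an antecedent, and K
    discharges it. *)
Lemma maximal_Box_consequence a (T : eqType) (f : T -> Lprop) (s : seq T) b :
  (forall t, t \in s -> X (Box a (f t))) ->
  (forall v, (forall t, t \in s -> eval v (f t)) -> eval v b) ->
  X (Box a b).
Proof.
elim: s b => [|t s IHs] b Xs sb.
  (* Here [b] is a tautology. In place of a necessitation rule, RW weakens the boxed formula
     supplied by R. *)
  apply: (maximal_mp Xmax _ (maximal_Box_int a)).
  apply/(maximal_thm Xmax)/AX_RW/tautology_provable => v.
  by apply/eval_Imp => _; apply: sb.
apply: (maximal_mp Xmax _ (Xs t (mem_head _ _))).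
apply: (maximal_mp Xmax (maximal_thm Xmax (AX_K _ _ _ _))).
apply: IHs => [u us|v vs]; first by apply: Xs; rewrite inE us orbT.
apply/eval_Imp => vt; apply: sb => u; rewrite inE => /predU1P[->//|].
exact: vs.
Qed.

Lemma maximal_Box_weaken a b c :
  X (Box a b) -> (forall v, eval v b -> eval v c) -> X (Box a c).
Proof.
move=> Xb bc; apply: (@maximal_Box_consequence _ unit (fun=> b) [:: tt]) => // v.
by move=> /(_ tt (mem_head _ _))/bc.
Qed.

End Boxes.

End MaximalTheories.
(** * Soundness *)

Lemma set_cellE (x : tape) i b j :
  set_cell x i b j = if j == i then b else x j.
Proof.
rewrite fsfunE in_fset1U; case: eqP => //= _; case: ifPn => //.
by rewrite memNfinsupp => /eqP.
Qed.

Definition agrees (a : Lint) (x : tape) : Prop :=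
  forall l, l \in literals a -> x l.1 = l.2.

Lemma tape_sat_int a y : tape_sat y (form_of_int a) <-> agrees a y.
Proof.
rewrite /tape_sat eval_conj_lits; split=> ay l /ay; last by move=> ->.
by move=> H; apply/idP/idP => /H.
Qed.

Lemma literals_uniq a : uniq [seq l.1 | l <- literals a].
Proof. by case: a => s /= ss; apply: (sorted_uniq ltn_trans ltnn). Qed.

(** The literals concern distinct variables, so no later assignment overwrites an earlier one. *)
Lemma agrees_set_lits a x : agrees a (set_lits a x).
Proof.
rewrite /agrees /set_lits; move: (literals_uniq a); move: (literals a) x.
elim/last_ind => [//|s k IHs] x; rewrite map_rcons rcons_uniq => /andP[ks us] l.
rewrite foldl_rcons set_cellE mem_rcons inE => /predU1P[->|ls].
  by rewrite eqxx.
by case: eqP => [lk|_]; [rewrite -lk map_f in ks|apply: IHs].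
Qed.

Lemma agrees_write a x i b : agrees a x -> agrees a (write a x i b).
Proof.
move=> ax l la; rewrite /write; case: ifPn => [_|ni]; first exact: ax.
rewrite set_cellE; case: eqP => [li|_]; last exact: ax.
by rewrite /intervened -li map_f in ni.
Qed.

Lemma invariant_reachable T a (P : config T -> Prop) c d :
  (forall c d, P c -> step a c d -> P d) -> P c ->
  clos_refl_trans _ (@step T a) c d -> P d.
Proof. by move=> stepP + cd; elim: cd => [u v /[swap]/stepP|//|]; auto. Qed.

(** The semantic content of R: the fixed cells are set at the start and keep their values at every
    step. *)
Lemma yields_agrees T a x y : yields T a x y -> agrees a y.
Proof.
move=> [c [xc _ <-]].
apply: (invariant_reachable (P := fun c => agrees a (cfg_tape c)) _ _ xc).
  by move=> d e + de; case: de => *; apply: agrees_write.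
exact: agrees_set_lits.
Qed.

(** * Deterministic and halting runs *)

Lemma deterministic_step T a (c d e : config T) :
  deterministic T -> step a c d -> step a c e -> d = e.
Proof.
move=> dT cd; case: cd e => q h x q1 b1 m1 t1 e ce.
inversion ce as [q0 h0 x0 q2 b2 m2 t2 [E1 E2 E3]].
by have [-> -> ->] := dT _ _ _ _ _ _ _ _ t1 t2.
Qed.

(** The two runs share every step, and neither can stop before the other because both end in halted
    configurations. *)
Lemma deterministic_yields T a x y z :
  deterministic T -> yields T a x y -> yields T a x z -> y = z.
Proof.
move=> dT [c [/clos_rt_rt1n_iff xc hc <-]] [d [/clos_rt_rt1n_iff xd hd <-]].
congr cfg_tape; elim: xc d xd hd hc => [u d|u v w uv vw IH d].
  by case=> // v w uv _ _ /(_ v).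
case=> [/(_ v)//|t t' ut /[swap]].
by rewrite -(deterministic_step dT uv ut) => *; apply: IH.
Qed.

(** Without an output, every reachable configuration has a successor, and choice strings these into
    an infinite run. *)
Lemma halts_yields T a x : halts T a x -> exists y, yields T a x y.
Proof.
move=> hx; apply: contrapT => /forallNP ny; apply: hx.
pose R := clos_refl_trans _ (@step T a) (init T a x).
have next c : exists d, R c -> step a c d.
  have [Rc|] := EM (R c); last by exists c.
  have /existsNP[d /contrapT cd] : ~ halted a c.
    by move=> hc; apply: (ny (cfg_tape c)); exists c.
  by exists d.
have [f Pf] := choice next; exists (fun n => iter n f (init T a x)).
split=> // n; apply: (Pf); elim: n => [|n IHn]; first exact: rt_refl.
exact: rt_trans IHn (rt_step _ _ _ _ (Pf _ IHn)).
Qed.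

(** Closure of [C] under change of tape serves RW: the premise is applied to the model whose tape is
    the output [y]. *)
Lemma AX_plus_sound (C : model -> Prop) (Ax : L -> Prop) phi :
  (forall T x y, C (Model T x) -> C (Model T y)) ->
  (forall M p, C M -> Ax p -> sat M p) ->
  AX_plus Ax phi -> forall M, C M -> sat M phi.
Proof.
move=> CT CAx; elim=> {phi}
  [p pcp|p q _ IHpq _ /[swap] M + CM|a b b' _ IH|a|a b c|p /[swap] M /CAx].
- move=> M _; rewrite /sat; case: pcp => *; rewrite ?eval_Imp /=;
  try match goal with |- context [eval ?v ?p] => have [] := EM (eval v p) end;
  tauto.
- by move=> /(_ M CM); move/eval_Imp: (IHpq M CM).
- move=> [T x] CM; apply/eval_Imp => /= xb y Ty.
  have /eval_emb/eval_Imp := IH _ (CT _ _ y CM); apply; exact: xb.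
- by move=> [T x] _ y /yields_agrees ay; apply/tape_sat_int.
- move=> [T x] _; apply/eval_Imp => xbc; apply/eval_Imp => xb y Ty.
  by have /eval_Imp := xbc y Ty; apply; apply: xb.
- by move=> H /H.
Qed.

Lemma axiom_F_sound M p : M_det M -> axiom_F p -> sat M p.
Proof.
case: M => T x dT [a b]; apply/eval_Imp => nb y Ty; apply: contrapT => yb.
apply: nb => z Tz; by rewrite -(deterministic_yields dT Ty Tz).
Qed.

Lemma axiom_D_sound M p : M_halt M -> axiom_D p -> sat M p.
Proof.
case: M => T x hT [a b]; apply/eval_Imp => xb xnb.
have [y Ty] := halts_yields (hT a x); exact: xnb y Ty (xb y Ty).
Qed.

Lemma soundness v phi :
  provable v phi -> forall M, model_class v M -> sat M phi.
Proof.
case: v; apply: AX_plus_sound => // M p CM.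
- exact: axiom_F_sound.
- exact: axiom_D_sound.
- by case=> [/(axiom_F_sound CM.1)|/(axiom_D_sound CM.2)].
Qed.
(** * A machine that detects the intervention *)

Section Detector.

Variable N : nat.

(** Test results: [Some b] for a cell fixed to [b], [None] for a free one. *)
Definition info : finType := {ffun 'I_N -> option bool}.
Definition assignment : finType := {ffun 'I_N -> bool}.

Definition info_of (a : Lint) : info :=
  [ffun j : 'I_N =>
     if intervened a j then Some ((j : nat, true) \in literals a) else None].

Definition note (f : info) (j : 'I_N) (o : option bool) : info :=
  [ffun i => if i == j then o else f i].

Definition compatible (a : Lint) (w : assignment) : Prop :=
  forall j b, (nat_of_ord j, b) \in literals a -> w j = b.

(** The outputs [w] that the machine may choose after the test results [f]. *)
Variable S : info -> assignment -> Prop.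

Definition detector_state : finType :=
  ('I_N.+1 * info * option bool + 'I_N.+1 * assignment)%type.

(* A cell is fixed exactly when it keeps its value after an attempt to flip it.
   In state [inl (i, f, o)] the cells before [i] have been tested, with results
   [f], and [o] is the bit read in cell [i] before flipping it.  In state
   [inr (k, w)] the cells from [k] on already contain [w]. *)
Inductive detector_trans :
    detector_state -> bool -> detector_state -> bool -> move -> Prop :=
  | Flip (j : 'I_N) (i : 'I_N.+1) f b :
      i = j :> nat ->
      detector_trans (inl (i, f, None)) b (inl (i, f, Some b)) (~~ b) Stay
  | Reread (j : 'I_N) (i i' : 'I_N.+1) f c b :
      i = j :> nat -> i' = j.+1 :> nat ->
      detector_trans (inl (i, f, Some c)) b
        (inl (i', note f j (if b == c then Some c else None), None)) b MoveR
  | Choose (i : 'I_N.+1) f w b :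
      i = N :> nat -> S f w ->
      detector_trans (inl (i, f, None)) b (inr (i, w)) b MoveL
  | Spin (i : 'I_N.+1) f b :
      i = N :> nat -> (forall w, ~ S f w) ->
      detector_trans (inl (i, f, None)) b (inl (i, f, None)) b Stay
  | Put (j : 'I_N) (k k' : 'I_N.+1) w b :
      k = j.+1 :> nat -> k' = j :> nat ->
      detector_trans (inr (k, w)) b (inr (k', w)) (w j) MoveL.

(** States and bits are finite in number, so any [S] gives a finite transition table; [asbool] makes
    it boolean. *)
Definition detector : TM :=
  MkTM (inl (ord0, [ffun=> None], None) : detector_state)
    (fun q b q' b' m => `[< detector_trans q b q' b' m >]).

Lemma detector_step a q h (x : tape) q' b m :
  detector_trans q (x h) q' b m ->
  step a (@Config detector q h x)
    (@Config detector q' (move_head m h) (write a x h b)).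
Proof. by move=> t; apply: Step; apply/asboolP. Qed.

Lemma detector_deterministic :
  (forall f w w', S f w -> S f w' -> w = w') -> deterministic detector.
Proof.
move=> Suniq q b q1 b1 m1 q2 b2 m2 /asboolP t1 /asboolP t2.
(* Separates the rules that handle a cell below [N] from those that apply at [N]. *)
have noN (j : 'I_N) (i : 'I_N.+1) : i = j :> nat -> i = N :> nat -> False.
  by move=> -> jN; move: (ltn_ord j); rewrite jN ltnn.
case: t1 t2 => [j i f c ij|j i i' f c d ij i'j|i f w c iN Sw|i f c iN nS
               |j k k' w c kj k'j] t2;
  inversion t2 as [j2 i2 f2 c2 ij2|j2 i2 i2' f2 c2 d2 ij2 i'j2
                  |i2 f2 w2 c2 iN2 Sw2|i2 f2 c2 iN2 nS2
                  |j2 k2 k2' w2 c2 kj2 k'j2]; subst => //.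
- by case: (noN j i).
- by case: (noN j i).
- have jj : j = j2 by apply/val_inj; rewrite /= -ij.
  by rewrite jj; congr (inl (_, _, _), _, _); apply/val_inj; rewrite /= i'j i'j2 jj.
- by case: (noN j2 i).
- by rewrite (Suniq _ _ _ Sw Sw2).
- by case: (nS2 w).
- by case: (noN j2 i).
- by case: (nS w2).
- have jj : j = j2 by apply/val_inj/succn_inj; rewrite /= -kj.
  by rewrite jj; congr (inr (_, _), _, _); apply/val_inj; rewrite /= k'j k'j2 jj.
Qed.

(** Each remaining cell costs two steps, flip and reread. The offset [N.+1] puts every testing state
    above every writing state, where [k <= N]. Only [Spin] fails to decrease the rank. *)
Definition detector_rank (q : detector_state) : nat :=
  match q with
  | inl (i, _, o) => N.+1 + (N - i).*2 + (o == None)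
  | inr (k, _) => k
  end.

Lemma detector_halts a x : (forall f, exists w, S f w) -> halts detector a x.
Proof.
move=> Sex [run [_ runS]].
have dec n : detector_rank (cfg_state (run n.+1)) <
    detector_rank (cfg_state (run n)).
  case: (runS n) => q h y q' b m /asboolP [] /=.
  - by move=> j i f c _; rewrite addn0 addn1.
  - move=> j i i' f c d -> ->; rewrite addn1 addn0 -addnS ltn_add2l.
    by rewrite -(subnSK (ltn_ord j)) doubleS.
  - by move=> i f w c ->  _; rewrite subnn addn0 addn1 ltnS leqnSn.
  - by move=> i f c _ nS; have [w /nS] := Sex f.
  - by move=> j k k' w c -> ->.
have bnd n : detector_rank (cfg_state (run n)) + n <=
    detector_rank (cfg_state (run 0)).
  elim: n => [|n IHn]; first by rewrite addn0.
  by apply: leq_trans IHn; rewrite addnS -addSn leq_add2r dec.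
have := bnd (detector_rank (cfg_state (run 0))).+1.
by move=> /(leq_trans (leq_addl _ _)); rewrite ltnn.
Qed.

(** * Invariant of the detector's runs *)

Lemma info_of_agrees a x (j : 'I_N) :
  agrees a x -> intervened a j -> info_of a j = Some (x j).
Proof.
move=> ax ja; rewrite ffunE ja; congr Some.
case/mapP: ja => -[i b] la /= ji; have /= xb := ax _ la.
rewrite ji xb; case: b la {xb} => // la; apply/negP => lt.
by have := ax _ lt; rewrite (ax _ la).
Qed.

(** After a flip, the cell still holds the old bit exactly when it is fixed. While writing, the next
    cell is [k.-1]; at [k = 0] the head rests on the first cell. *)
Definition detector_inv (a : Lint) (c : config detector) : Prop :=
  agrees a (cfg_tape c) /\
  match cfg_state c with
  | inl (i, f, o) =>
      [/\ cfg_head c = i,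
          f = [ffun j : 'I_N => if j < i then info_of a j else None]
        & if o is Some b then
            i < N /\ (cfg_tape c i == b) = intervened a i else True]
  | inr (k, w) =>
      [/\ cfg_head c = k.-1, S (info_of a) w
        & forall j : 'I_N, k <= j -> cfg_tape c j = w j]
  end.

Lemma detector_inv_step a c d :
  (forall w, S (info_of a) w -> compatible a w) ->
  detector_inv a c -> step a c d -> detector_inv a d.
Proof.
move=> Sa + cd; case: c d / cd => q h x q' b m /asboolP + [/= ax].
move Exh: (x h) => r t qI; split=> /=; first exact: agrees_write.
case: t Exh qI => [j i f c ij xh [hi ff _]
                  |j i i' f c d ij i'j xh [hi ff [iN xi]]
                  |i f w c iN Sw _ [hi ff _]|i f c iN nS _ [hi ff _]
                  |j k k' w c kj k'j _ [hk Sw xw]] /=.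
- split=> //; split; first by rewrite ij.
  rewrite /write hi; case: ifP => _; first by rewrite -xh hi eqxx.
  by rewrite set_cellE eqxx; case: (c).
- split=> //=; first by rewrite hi i'j ij.
  rewrite ff; apply/ffunP => u; rewrite !ffunE i'j ltnS ij.
  case: (ltngtP u j) => [uj|uj|/val_inj uj].
  + by rewrite ifN //; apply: contraTneq uj => ->; rewrite ltnn.
  + by rewrite ifN //; apply: contraTneq uj => ->; rewrite ltnn.
  + rewrite uj eqxx -xh hi xi ij.
    case: ifPn => // ja; have := info_of_agrees ax ja; rewrite ffunE ja => ->.
    by rewrite ij ja in xi; rewrite (eqP xi).
- have -> : info_of a = f.
    by rewrite ff; apply/ffunP => u; rewrite [RHS]ffunE iN ltn_ord.
  split=> //; first by rewrite hi.
  by move=> u; rewrite iN leqNgt ltn_ord.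
- by [].
- split=> //; first by rewrite hk kj k'j.
  move=> u; rewrite k'j leq_eqVlt hk kj /= /write => /predU1P[/val_inj <-|ju].
    case: ifPn => [|_]; last by rewrite set_cellE eqxx.
    (* A fixed cell ignores the write, but it already holds the value that compatibility requires of
       [w]. *)
    case/mapP => -[i d] la /= ji; have /= -> : x j = d by rewrite ji (ax _ la).
    by apply/esym/(Sa w Sw); rewrite ji.
  case: ifPn => _; first by apply: xw; rewrite kj.
  by rewrite set_cellE (gtn_eqF ju); apply: xw; rewrite kj.
Qed.

Lemma detector_inv_init a x : detector_inv a (init detector a x).
Proof.
split=> /=; first exact: agrees_set_lits.
by split=> //; apply/ffunP => j; rewrite !ffunE.
Qed.

(** Every configuration satisfying the invariant can move, except in a state [inr (k, w)] with
    [k = 0], where all [N] cells contain [w]. *)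
Lemma detector_yields_inv a x y :
  (forall w, S (info_of a) w -> compatible a w) ->
  yields detector a x y ->
  exists2 w, S (info_of a) w & forall j : 'I_N, y j = w j.
Proof.
move=> Sa [c [xc + <-]].
have := invariant_reachable (fun _ _ => detector_inv_step Sa)
  (detector_inv_init a x) xc.
case: c {xc} => -[[[i f] o]|[k w]] h z /= [_ cI] hc.
  case: (ltnP i N) => [iN|Ni].
    have ij : i = Ordinal iN :> nat by [].
    have i'j : Ordinal (iN : i.+1 < N.+1) = (Ordinal iN).+1 :> nat by [].
    case: o cI hc => [c|] _ hc.
      by case: (hc _ (detector_step (h := h) a (Reread f c (z h) ij i'j))).
    by case: (hc _ (detector_step (h := h) a (Flip f (z h) ij))).
  have iN : i = N :> nat by apply/eqP; rewrite eqn_leq Ni -ltnS ltn_ord.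
  case: o cI hc => [c [_ _ []]|_ hc]; first by rewrite iN ltnn.
  have [[w Sw]|/forallNP nS] := EM (exists w, S f w).
    by case: (hc _ (detector_step (h := h) a (Choose (z h) iN Sw))).
  by case: (hc _ (detector_step (h := h) a (Spin (z h) iN nS))).
case: cI => _ Sw zw; exists w => // j; apply: zw.
case: (posnP k) => [-> //|k0].
have kN : k.-1 < N by rewrite prednK // -ltnS ltn_ord.
have kj : k = (Ordinal kN).+1 :> nat by rewrite /= prednK.
have k'j : Ordinal (ltnW kN : k.-1 < N.+1) = Ordinal kN :> nat by [].
by case: (hc _ (detector_step (h := h) a (Put w (z h) kj k'j))).
Qed.

(** Only the existence of the run is recorded; the invariant later determines [f']. *)
Lemma detector_probes a (i : 'I_N.+1) f h x :
  exists f' h' x', clos_refl_trans _ (@step detector a)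
    (@Config detector (inl (i, f, None)) h x)
    (@Config detector (inl (ord_max, f', None)) h' x').
Proof.
have [n] := ubnP (N - i); elim: n => // n IHn in i f h x *; rewrite ltnS => le_n.
case: (ltnP i N) => [iN|Ni]; last first.
  exists f, h, x; have -> : i = ord_max.
    by apply/val_inj/eqP; rewrite /= eqn_leq Ni -ltnS ltn_ord.
  exact: rt_refl.
have ij : i = Ordinal iN :> nat by [].
have i'j : Ordinal (iN : i.+1 < N.+1) = (Ordinal iN).+1 :> nat by [].
have s1 := detector_step (h := h) a (Flip f (x h) ij).
set x1 := write a x h _ in s1.
have s2 := detector_step (h := h) a (Reread f (x h) (x1 h) ij i'j).
have [|f' [h' [x' r]]] := IHn (Ordinal (iN : i.+1 < N.+1))
    (note f (Ordinal iN) (if x1 h == x h then Some (x h) else None))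
    h.+1 (write a x1 h (x1 h)).
  by apply: leq_trans le_n; rewrite /= ltn_sub2l.
exists f', h', x'; apply: rt_trans (rt_step _ _ _ _ s1) _.
exact: rt_trans (rt_step _ _ _ _ s2) r.
Qed.

Lemma detector_writes a (k : 'I_N.+1) w h x :
  exists h' x', clos_refl_trans _ (@step detector a)
    (@Config detector (inr (k, w)) h x)
    (@Config detector (inr (ord0, w)) h' x').
Proof.
case: k => k kN; elim: k => [|k IHk] in kN h x *.
  by exists h, x; rewrite (_ : Ordinal kN = ord0); [apply: rt_refl|apply/val_inj].
have kj : Ordinal kN = (Ordinal (kN : k < N)).+1 :> nat by [].
have k'j : Ordinal (ltnW kN) = Ordinal (kN : k < N) :> nat by [].
have st := detector_step (h := h) a (Put w (x h) kj k'j).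
have [h' [x' r]] := IHk (ltnW kN) h.-1 (write a x h (w (Ordinal (kN : k < N)))).
by exists h', x'; apply: rt_trans (rt_step _ _ _ _ st) r.
Qed.

Lemma detector_yields a x w :
  (forall w, S (info_of a) w -> compatible a w) -> S (info_of a) w ->
  exists2 y, yields detector a x y & forall j : 'I_N, y j = w j.
Proof.
move=> Sa Sw.
have [f [h [z r1]]] := detector_probes a ord0 [ffun=> None] 0 (set_lits a x).
have [_ [_ ff _]] := invariant_reachable (fun _ _ => detector_inv_step Sa)
  (detector_inv_init a x) r1.
have {}ff : f = info_of a.
  by rewrite ff; apply/ffunP => u; rewrite [LHS]ffunE ltn_ord.
rewrite -ff in Sw.
have st := detector_step (h := h) a (Choose (i := ord_max) (z h) erefl Sw).
have [h' [y r2]] := detector_writes a ord_max w h.-1 (write a z h (z h)).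
have xy := rt_trans _ _ _ _ _ r1 (rt_trans _ _ _ _ _ (rt_step _ _ _ _ st) r2).
have [_ [_ _ yw]] := invariant_reachable (fun _ _ => detector_inv_step Sa)
  (detector_inv_init a x) xy.
exists y; last by move=> j; apply: yw.
exists (@Config detector (inr (ord0, w)) h' y); split=> // d sd.
inversion sd as [q0 h0 x0 q' b m t]; move/asboolP: t => t.
by inversion t as [| | | |j k k' v c kj].
Qed.

End Detector.
(** * Completeness *)

Section CanonicalModel.

Variables (Ax : L -> Prop) (phi : L) (X : L -> Prop) (N : nat).
Hypothesis Xmax : maximal_avoiding Ax phi X.

(** Cells from [N] on are read as false; formulas bounded by [N] do not mention them. *)
Definition value_at (w : assignment N) (i : nat) : bool :=
  if insub i is Some j then w j else false.

Definition diagram (w : assignment N) : Lprop :=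
  conj_lits [seq (nat_of_ord j, w j) | j <- enum 'I_N].

Lemma eval_diagram v w :
  eval v (diagram w) <-> forall j : 'I_N, v j <-> w j.
Proof.
rewrite eval_conj_lits; split=> [vw j|vw l /mapP[j _ ->]]; last exact: vw.
by apply: (vw (_, _)); apply: map_f; rewrite mem_enum.
Qed.

Lemma eval_value_at (v : nat -> Prop) (w : assignment N) b :
  bound succn b <= N -> (forall j : 'I_N, v j <-> w j) ->
  eval v b <-> eval (value_at w) b.
Proof.
move=> bN vw; apply: (eval_ext bN) => i iN.
by rewrite /value_at insubT; apply: (vw (Ordinal iN)).
Qed.

Definition possible (a : Lint) (w : assignment N) : Prop :=
  ~ X (Box a (Neg (diagram w))).

(** [X] boxes the negated diagrams of the finitely many impossible assignments. A valuation
    satisfying these negations has a possible restriction to the first [N] cells, hence satisfies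
    [b]. *)
Lemma Box_of_impossible a b :
  (forall v w, eval v (diagram w) -> possible a w -> eval v b) -> X (Box a b).
Proof.
move=> ab; pose s := [seq w <- enum (assignment N) | `[< ~ possible a w >]].
apply: (maximal_Box_consequence Xmax (f := fun w => Neg (diagram w)) (s := s)).
  by move=> w; rewrite mem_filter => /andP[/asboolP/contrapT].
move=> v vs; pose w : assignment N := [ffun j : 'I_N => `[< v j >]].
have vw : eval v (diagram w).
  by apply/eval_diagram => j; rewrite ffunE; split=> /asboolP.
apply: (ab v w vw) => Xw; apply: (vs w _ vw).
by rewrite mem_filter mem_enum andbT; apply/asboolP.
Qed.

(** If [b] fails at [w], then [b] entails [Neg (diagram w)], so boxing [b] would make [w]
    impossible. *)
Lemma Box_possible a b : bound succn b <= N ->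
  X (Box a b) <-> (forall w, possible a w -> eval (value_at w) b).
Proof.
move=> bN; split=> [Xb w aw|ab].
  apply: contrapT => nwb; apply: aw; apply: (maximal_Box_weaken Xmax Xb) => v vb vw.
  by apply/nwb/(eval_value_at bN _).1/vb/eval_diagram.
apply: Box_of_impossible => v w /eval_diagram vw /ab.
by move/(eval_value_at bN vw).
Qed.

(** F boxes the diagram of [w], which excludes the diagram of any other assignment. *)
Lemma possible_unique a w w' :
  (forall p, axiom_F p -> Ax p) -> possible a w -> possible a w' -> w = w'.
Proof.
move=> AxF aw; apply: contra_notP => ww'.
have /maximal_mp : X (Imp (Dia a (diagram w)) (Box a (diagram w))).
  exact/(maximal_thm Xmax)/AX_extra/AxF.
move=> /(_ _ _ Xmax (proj2 (maximal_Neg Xmax _) aw)) Xw.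
apply: (maximal_Box_weaken Xmax Xw) => v /eval_diagram vw /eval_diagram vw'.
apply: ww'; apply/ffunP => j; apply/idP/idP => [/vw/vw'|/vw'/vw] //.
Qed.

(** Otherwise [X] boxes every formula, against D for the contradiction [Neg Top]. *)
Lemma possible_exists a :
  (forall p, axiom_D p -> Ax p) -> exists w, possible a w.
Proof.
move=> AxD; apply: contrapT => /forallNP nw.
have /maximal_mp : X (Imp (Box a (Neg Top)) (Dia a (Neg Top))).
  exact/(maximal_thm Xmax)/AX_extra/AxD.
move=> /(_ _ _ Xmax); have Xf b : X (Box a b).
  by apply: Box_of_impossible => v w _ /nw.
by move=> /(_ (Xf _))/(maximal_Neg Xmax); apply.
Qed.

(** * Recovering an intervention from its test results *)

Definition supported (a : Lint) : Prop := bound succn (form_of_int a) <= N.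

Lemma supported_literal a l : supported a -> l \in literals a -> l.1 < N.
Proof.
rewrite /supported /form_of_int; elim: (literals a) => // k [|k' s] IHs.
  by rewrite inE => + /eqP->; case: k => i [].
rewrite inE [bound _ _]/= -/(conj_lits (k' :: s)) geq_max => /andP[kN sN].
by case/predU1P => [->|/(IHs sN)//]; case: k kN => i [].
Qed.

Lemma mem_literals a (j : 'I_N) b :
  ((j : nat, b) \in literals a) = (info_of N a j == Some b).
Proof.
(* A tape agreeing with [a] rules out opposite literals on one cell. *)
have [x ax] : exists x, agrees a x.
  by exists (set_lits a [fsfun]); apply: agrees_set_lits.
apply/idP/eqP => [jb|].
  have ja : intervened a j by apply: (map_f fst jb).
  by rewrite (info_of_agrees ax ja); congr Some; apply: (ax _ jb).
have [ja|/negbTE nja] := boolP (intervened a j); last by rewrite ffunE nja.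
rewrite (info_of_agrees ax ja) => -[<-].
by case/mapP: ja => -[i c] la /= ->; have /= -> := ax _ la.
Qed.

(** The test results determine the literals on the first [N] cells, and a list sorted by variable is
    determined by its members. *)
Lemma info_of_inj a a' :
  supported a -> supported a' -> info_of N a = info_of N a' -> a = a'.
Proof.
move=> sa sa' aa'; apply: val_inj; rewrite -/(literals a) -/(literals a').
have key_sorted c : sorted (fun k l : nat * bool => k.1 < l.1) (literals c).
  by have := valP c; rewrite sorted_map.
apply: (@irr_sorted_eq _ (fun k l : nat * bool => k.1 < l.1)) => //.
- by move=> k l m; apply: ltn_trans.
- by move=> k; apply: ltnn.
move=> [i b]; have [iN|Ni] := ltnP i N.
  by rewrite (mem_literals a (Ordinal iN)) (mem_literals a' (Ordinal iN)) aa'.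
by apply/idP/idP => [/(supported_literal sa)|/(supported_literal sa')] /=;
  rewrite ltnNge Ni.
Qed.

(** By R, [X] boxes [a] itself, so [a] is true at every possible assignment. *)
Lemma possible_compatible a w : supported a -> possible a w -> compatible a w.
Proof.
move=> sa aw j b jb.
have /(Box_possible a sa)/(_ w aw)/eval_conj_lits/(_ _ jb) := maximal_Box_int Xmax a.
rewrite /value_at /= insubT // => jN; rewrite (_ : Sub _ _ = j); last exact/val_inj.
by move=> H; apply/idP/idP => /H.
Qed.

(* The second disjunct only keeps the machine deterministic and halting on
   test results that no supported intervention produces. *)
Definition canonical_choice (f : info N) (w : assignment N) : Prop :=
  (exists a, [/\ supported a, info_of N a = f & possible a w]) \/
  (forall a, supported a -> info_of N a <> f) /\ w = [ffun=> false].

Lemma canonical_choice_supported a w :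
  supported a -> canonical_choice (info_of N a) w <-> possible a w.
Proof.
move=> sa; split=> [[[c [sc /(info_of_inj sc sa)->]] //|[/(_ a sa)]//]|aw].
by left; exists a.
Qed.

Lemma canonical_choice_unique f w w' :
  (forall p, axiom_F p -> Ax p) ->
  canonical_choice f w -> canonical_choice f w' -> w = w'.
Proof.
move=> AxF [[a [sa af aw]]|[nf ->]] [[c [sc cf cw]]|[nf' ->]] //.
- move: cf cw; rewrite -af => /(info_of_inj sc sa)->.
  exact: possible_unique.
- by case: (nf' a).
- by case: (nf c).
Qed.

Lemma canonical_choice_exists f :
  (forall p, axiom_D p -> Ax p) -> exists w, canonical_choice f w.
Proof.
move=> AxD; have [[a [sa af]]|nf] := EM (exists a, supported a /\ info_of N a = f).
  by have [w aw] := possible_exists a AxD; exists w; left; exists a.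
by exists [ffun=> false]; right; split=> // a sa af; apply: nf; exists a.
Qed.

(** Restricting to the first [N] cells keeps the support finite. *)
Definition canonical_tape : tape :=
  [fsfun i in seq_fset tt (iota 0 N) => `[< X (Atom (inl i)) >] | false].

Definition canonical_model : model :=
  Model (detector canonical_choice) canonical_tape.

Definition atom_bound (x : nat + Lcond) : nat :=
  match x with
  | inl i => i.+1
  | inr (a, b) => maxn (bound succn (form_of_int a)) (bound succn b)
  end.

Lemma canonical_atom x : atom_bound x <= N ->
  atom_sat canonical_model x <-> X (Atom x).
Proof.
case: x => [i iN|[a b]] /=.
  rewrite fsfunE seq_fsetE mem_iota iN /=; split=> /asboolP //.
rewrite geq_max => /andP[sa bN]; rewrite -/(Box a b) (Box_possible a bN).
have Sa w : canonical_choice (info_of N a) w -> compatible a w.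
  by move/(canonical_choice_supported w sa); apply: possible_compatible.
have yw (y : tape) (w : assignment N) :
    (forall j : 'I_N, y j = w j) -> tape_sat y b <-> eval (value_at w) b.
  by move=> H; apply: (eval_value_at bN) => j; rewrite H.
split=> [Tb w aw|ab y].
  have [y Ty /yw <-] := detector_yields canonical_tape Sa
    (proj2 (canonical_choice_supported w sa) aw).
  exact: Tb.
by move=> /(detector_yields_inv Sa)[w /(canonical_choice_supported w sa)/ab + /yw ->].
Qed.

End CanonicalModel.

(** The conditions on [C] depend only on which of F and D belong to [Ax], so one argument covers all
    four systems. *)
Lemma completeness (C : model -> Prop) (Ax : L -> Prop) phi :
  (forall M, ((forall p, axiom_F p -> Ax p) -> M_det M) ->
    ((forall p, axiom_D p -> Ax p) -> M_halt M) -> C M) ->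
  (forall M, C M -> sat M phi) -> AX_plus Ax phi.
Proof.
move=> CAx Cphi; apply: contrapT => /exists_maximal_avoiding[X Xmax].
apply: (Xmax.1); apply/derives_hyp/(maximal_truth Xmax).
(* This [N] bounds the variables of [phi], including those inside its interventions and their
   consequents. *)
pose N := bound atom_bound phi; pose M := canonical_model X N.
have : sat M phi.
  apply/Cphi/CAx => [AxF|AxD a x].
    by apply: detector_deterministic => f w w'; apply: (canonical_choice_unique Xmax AxF).
  by apply: detector_halts => f; apply: (canonical_choice_exists Xmax f AxD).
apply: (proj1 (eval_ext (leqnn N) _)) => x xN.
exact: (canonical_atom Xmax).
Qed.

Theorem theorem1 (v : variant) (phi : L) :
  provable v phi <-> (forall M : model, model_class v M -> sat M phi).
Proof.
split; first exact: soundness.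
case: v => Cphi; apply: completeness Cphi => M Mdet Mhalt //.
- exact: Mdet.
- exact: Mhalt.
- by split; [apply: Mdet|apply: Mhalt] => p; [left|right].
Qed.
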